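(* Let $n\ge 2$ and let $E_1,\ldots,E_n$ be real topological vector spaces. Let $T:=E_1\otimes_{\mathbb{R}}\cdots\otimes_{\mathbb{R}}E_n$ be the (algebraic) tensor product of the vector spaces $E_1,\ldots,E_n$, and let $\tau:E_1\times\cdots\times E_n\to T$, $\tau(x_1,\ldots,x_n):=x_1\otimes\cdots\otimes x_n$. Let $\mathcal{B}$ be the set of all subsets $U$ of $T$ of the form $$U=\sum_{k\in\mathbb{N}}\tau(U_{k,1}\times\cdots\times U_{k,n}):=\bigcup_{k\in\mathbb{N}}\,\sum_{\ell=1}^{k}\tau(U_{\ell,1}\times\cdots\times U_{\ell,n}),$$ where $(U_{k,j})_{k\in\mathbb{N}}$ is a sequence of balanced zero-neighbourhoods in $E_j$, for $j=1,\ldots,n$. Then the following holds: (a) $\mathcal{B}$ is a basis for the filter of zero-neighbourhoods of some topology $\mathcal{O}$ on $T$ making $T$ a real topological vector space. (b) $\tau:E_1\times\cdots\times E_n\to(T,\mathcal{O})$ is continuous. (c) $(T,\mathcal{O})$, together with the continuous $n$-linear map $\tau$, is a tensor product of $E_1,\ldots,E_n$ in the category of real topological vector spaces. (d) If $E_1,\ldots,E_n$ are Hausdorff, then $T$ is Hausdorff and hence is the tensor product of $E_1,\ldots,E_n$ in the category of Hausdorff real topological vector spaces. (e) If $E_1,\ldots,E_n$ are Hausdorff, then $(T,\mathcal{O})$, considered as an abelian topological group, together with the continuous $n$-additive map $\tau$, is a tensor product of the Hausdorff abelian topological groups $(E_1,+),\ldots,(E_n,+)$ in the category of Hausdorff abelian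 topological groups.
   Context: $\mathbb{N}=\{1,2,\ldots\}$. Topological vector spaces and topological groups are not presumed Hausdorff unless stated; topological vector spaces are not presumed locally convex. Sums of sets are Minkowski sums. Let $\mathcal{A}$ be a class of real topological vector spaces (resp., of abelian topological groups) closed under finite cartesian products. Given $E_1,\ldots,E_n\in\mathcal{A}$ ($n\ge2$), a tensor product of $E_1,\ldots,E_n$ in the class (category) $\mathcal{A}$ is an element $T\in\mathcal{A}$ together with an $n$-linear (resp., $n$-additive, i.e. additive in each variable) continuous map $\tau:E_1\times\cdots\times E_n\to T$ such that for every $E\in\mathcal{A}$ and every $n$-linear (resp., $n$-additive) continuous map $f:E_1\times\cdots\times E_n\to E$ there exists a unique continuous linear map (resp., continuous homomorphism) $\widetilde f:T\to E$ with $\widetilde f\circ\tau=f$. *)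

(* Defs.v *)
From HB Require Import structures.
From mathcomp Require Import all_boot all_order all_algebra generic_quotient.
From mathcomp Require Import all_classical all_reals all_analysis.

Set Implicit Arguments.
Unset Strict Implicit.
Unset Printing Implicit Defensive.

Import Order.TTheory GRing.Theory Num.Theory.
Import numFieldNormedType.Exports.
Local Open Scope classical_set_scope.
Local Open Scope ring_scope.

(* [dfwith x i y] is the family [x] with its [i]-th entry replaced by [y]. *)
Definition multilinear (R : pzRingType) (n : nat) (V : 'I_n -> lmodType R)
    (W : lmodType R) (f : (forall i, V i) -> W) : Prop :=
  forall (x : forall i, V i) (i : 'I_n),
    linear (fun y : V i => f (dfwith x i y)).

Definition multiadditive (n : nat) (V : 'I_n -> zmodType) (W : zmodType)
    (f : (forall i, V i) -> W) : Prop :=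
  forall (x : forall i, V i) (i : 'I_n),
    {morph (fun y : V i => f (dfwith x i y)) : y z / y + z}.

(* [T] is the algebraic tensor product of the [V i] and [tau] is the map
   (x_i)_i |-> x_1 (x) ... (x) x_n.  Such a pair is unique up to a unique
   isomorphism; existence is [tensor_product_exists] below. *)
Definition is_tensor_product (R : pzRingType) (n : nat) (V : 'I_n -> lmodType R)
    (T : lmodType R) (tau : (forall i, V i) -> T) : Prop :=
  multilinear tau /\
  forall (W : lmodType R) (f : (forall i, V i) -> W), multilinear f ->
    exists! g : T -> W, linear g /\ g \o tau = f.

(* A model: finite formal sums of scaled families, two of which are identified
   when every multilinear map takes the same value on them. *)
Section existence.
Variables (R : pzRingType) (n : nat) (V : 'I_n -> lmodType R).

Let pre := seq (R * (forall i, V i)).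

Let ev (W : lmodType R) (f : (forall i, V i) -> W) (s : pre) : W :=
  \sum_(p <- s) p.1 *: f p.2.

Let same (s t : pre) : bool :=
  `[< forall (W : lmodType R) (f : (forall i, V i) -> W),
        multilinear f -> ev f s = ev f t >].

Let same_refl : reflexive same.
Proof. by move=> s; apply/asboolP. Qed.

Let same_sym : symmetric same.
Proof.
by move=> s t; apply/asboolP/asboolP => st W f fL; rewrite st.
Qed.

Let same_trans : transitive same.
Proof.
move=> t s u /asboolP st /asboolP tu; apply/asboolP => W f fL.
by rewrite st// tu.
Qed.

Let same_equiv := EquivRel same same_refl same_sym same_trans.

Local Definition tensor_model : Type := {eq_quot same_equiv}%qT.
HB.instance Definition _ := Choice.on tensor_model.

Let cl (s : pre) : tensor_model := \pi_({eq_quot same_equiv}%qT)%qT s.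
Let rp (x : tensor_model) : pre := repr (x : {eq_quot same_equiv}%qT).

Let clP (s t : pre) : (forall (W : lmodType R) (f : (forall i, V i) -> W),
  multilinear f -> ev f s = ev f t) -> cl s = cl t.
Proof. by move=> st; apply/eqmodP/asboolP. Qed.

Let rpK (x : tensor_model) : cl (rp x) = x.
Proof. exact: reprK. Qed.

Let ev_rp (W : lmodType R) (f : (forall i, V i) -> W) (s : pre) :
  multilinear f -> ev f (rp (cl s)) = ev f s.
Proof.
move=> fL; have /eqmodP/asboolP : cl (rp (cl s)) = cl s by rewrite rpK.
exact.
Qed.

Let scale_seq (a : R) (s : pre) : pre := [seq (a * p.1, p.2) | p <- s].

Let ev_cat (W : lmodType R) (f : (forall i, V i) -> W) (s t : pre) :
  ev f (s ++ t) = ev f s + ev f t.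
Proof. by rewrite /ev big_cat. Qed.

Let ev_scale (W : lmodType R) (f : (forall i, V i) -> W) a (s : pre) :
  ev f (scale_seq a s) = a *: ev f s.
Proof.
rewrite /ev big_map scaler_sumr; apply: eq_bigr => p _ /=.
by rewrite scalerA.
Qed.

Let ev_nil (W : lmodType R) (f : (forall i, V i) -> W) : ev f [::] = 0.
Proof. by rewrite /ev big_nil. Qed.

Let zero := cl [::].
Let add x y := cl (rp x ++ rp y).
Let scale a x := cl (scale_seq a (rp x)).
Let opp x := scale (-1) x.

Let addA : associative add.
Proof. by move=> x y z; apply: clP => W f fL; rewrite !(ev_cat, ev_rp)// addrA. Qed.

Let addC : commutative add.
Proof. by move=> x y; apply: clP => W f fL; rewrite !ev_cat addrC. Qed.

Let add0 : left_id zero add.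
Proof.
move=> x; rewrite -[RHS]rpK; apply: clP => W f fL.
by rewrite ev_cat ev_rp// ev_nil add0r.
Qed.

Let addN : left_inverse zero opp add.
Proof.
move=> x; apply: clP => W f fL.
by rewrite ev_cat ev_rp// ev_scale ev_nil scaleN1r addNr.
Qed.

HB.instance Definition _ := GRing.isZmodule.Build tensor_model addA addC add0 addN.

Let scaleA a b x : scale a (scale b x) = scale (a * b) x.
Proof.
by apply: clP => W f fL; rewrite !(ev_scale, ev_rp)// scalerA.
Qed.

Let scale1 : left_id 1 scale.
Proof.
move=> x; rewrite -[RHS]rpK; apply: clP => W f fL.
by rewrite ev_scale scale1r.
Qed.

Let scaleDr : right_distributive scale +%R.
Proof.
move=> a x y; apply: clP => W f fL.
by rewrite !(ev_scale, ev_cat, ev_rp)// scalerDr.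
Qed.

Let scaleDl x : {morph scale^~ x : a b / a + b}.
Proof.
move=> a b; apply: clP => W f fL.
by rewrite !(ev_scale, ev_cat, ev_rp)// scalerDl.
Qed.

HB.instance Definition _ := GRing.Zmodule_isLmodule.Build R tensor_model
  scaleA scale1 scaleDr scaleDl.

Theorem tensor_product_exists :
  exists (T : lmodType R) (tau : (forall i, V i) -> T), is_tensor_product tau.
Proof.
pose tau (x : forall i, V i) : tensor_model := cl [:: (1, x)].
have ev1 (W : lmodType R) (f : (forall i, V i) -> W) x :
    ev f [:: (1, x)] = f x by rewrite /ev big_seq1 scale1r.
exists tensor_model, tau; split=> [x i a u v|W f fL].
  apply: clP => W f fL.
  by rewrite ev_cat !ev_rp// ev_scale ev_rp// !ev1 fL.
pose g (x : tensor_model) := ev f (rp x).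
exists g; split=> [|h [hL hf]].
  split=> [a x y|]; last by apply/funext => x; rewrite /g /= ev_rp// ev1.
  by rewrite /g ev_rp// ev_cat ev_rp// ev_scale.
have h0 : h 0 = 0.
  by have := hL (-1) 0 0; rewrite !scaleN1r addNr => ->; rewrite addNr.
have hZ a x : h (a *: x) = a *: h x by rewrite -[a *: x]addr0 hL h0 addr0.
apply/funext => x; rewrite /g -[in RHS](rpK x).
elim: (rp x) => [|[a y] s IHs]; first by rewrite ev_nil; exact: esym h0.
have -> : cl ((a, y) :: s) = a *: tau y + cl s.
  apply: clP => W' f' fL'.
  rewrite ev_cat !ev_rp// ev_scale ev_rp// ev1.
  by rewrite /ev big_cons.
by rewrite hL -IHs -hf /ev big_cons.
Qed.

End existence.

(* A tensor product of topological vector spaces in the full subcategory of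
   those topological vector spaces that satisfy [A].  A [topologicalLmodType]
   is neither assumed Hausdorff nor locally convex. *)
Definition is_tvs_tensor_product (R : realType)
    (A : topologicalLmodType R -> Prop) (n : nat)
    (E : 'I_n -> topologicalLmodType R) (T : topologicalLmodType R)
    (tau : prod_topology E -> T) : Prop :=
  [/\ A T, multilinear tau, continuous tau &
      forall (F : topologicalLmodType R) (f : prod_topology E -> F),
        A F -> multilinear f -> continuous f ->
        exists! g : T -> F, [/\ linear g, continuous g & g \o tau = f]].

Definition is_group_tensor_product (A : topologicalZmodType -> Prop) (n : nat)
    (E : 'I_n -> topologicalZmodType) (T : topologicalZmodType)
    (tau : prod_topology E -> T) : Prop :=
  [/\ A T, multiadditive tau, continuous tau &
      forall (F : topologicalZmodType) (f : prod_topology E -> F),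
        A F -> multiadditive f -> continuous f ->
        exists! g : T -> F,
          [/\ {morph g : x y / x + y}, continuous g & g \o tau = f]].

Definition balanced (R : realType) (V : lmodType R) (U : set V) : Prop :=
  forall (a : R) (x : V), `|a| <= 1 -> U x -> U (a *: x).

Definition minkowski_sum (V : zmodType) (k : nat) (S : nat -> set V) : set V :=
  [set \sum_(l < k) y l | y in [set y : nat -> V | forall l, (l < k)%N -> S l (y l)]].

(* The sets U_(k,1) x ... x U_(k,n) are indexed by k = 0, 1, ..., so that the
   union over k >= 1 of the sums of the first k sets is the union over k >= 0
   of the sums of the first k.+1 sets. *)
Definition tensor_nbhs_basis (R : realType) (n : nat)
    (E : 'I_n -> topologicalLmodType R) (T : lmodType R)
    (tau : (forall i, E i) -> T) : set_system T :=
  [set W | exists U : nat -> forall j, set (E j),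
     (forall k j, nbhs (0 : E j) (U k j) /\ balanced (U k j)) /\
     W = \bigcup_k minkowski_sum k.+1
           (fun l => tau @` [set x : forall j, E j | forall j, U l j (x j)])].

Record topology (T : Type) := Topology {
  topology_open : set_system T ;
  topology_openT : topology_open setT ;
  topology_openI : setI_closed topology_open ;
  topology_bigcup : forall (I : Type) (f : I -> set T),
    (forall i, topology_open (f i)) -> topology_open (\bigcup_i f i)
}.

Definition topologized (T : Type) (O : topology T) : Type := T.

Section topologized_instances.
Variables (R : realType) (T : lmodType R) (O : topology T).
HB.instance Definition _ := GRing.Lmodule.copy (topologized O) T.
HB.instance Definition _ := isOpenTopological.Build (topologized O)
  (@topology_openT T O) (@topology_openI T O) (@topology_bigcup T O).
End topologized_instances.

Definition is_vector_topology (R : realType) (T : lmodType R)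
    (O : topology T) : Prop :=
  continuous (fun z : topologized O * topologized O => z.1 + z.2) /\
  continuous (fun z : R^o * topologized O => z.1 *: z.2).

Section tvs_of.
Variables (R : realType) (T : lmodType R) (O : topology T).
Hypothesis OV : is_vector_topology O.

Definition tvs_of : topologicalLmodType R :=
  HB.pack (topologized O)
    (PreTopologicalNmodule_isTopologicalNmodule.Build (topologized O)
       (proj1 OV))
    (TopologicalNmodule_isTopologicalLmodule.Build R (topologized O)
       (proj2 OV)).
End tvs_of.

(* Main.v *)
(* The sets sum_k tau(U_(k,1) x ... x U_(k,n)) form a basis of a vector topology
   by elementary manipulations, and continuity of tau and of the factorizations
   through tau is checked on them directly.

   Hausdorffness is proved by induction on n, splitting T = E_0 (x) T'.  Let t
   be nonzero and suppose t = sum_l x_l (x) y_l with x_l in U_l and y_l in a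
   balanced set V_l.  Choose among the y_l a basis y_s of their span whose
   coordinate determinant has maximal modulus; by Cramer's rule
   y_l = sum_s c_(l,s) y_s with |c_(l,s)| <= 1, so
   t = sum_s x'_s (x) y_s with x'_s = sum_l c_(l,s) x_l in U := sum_l U_l.  If
   t = sum_q e_q (x) F_q with the e_q linearly independent, then
   x'_s = sum_q b_(s,q) e_q and F_q = sum_s b_(s,q) y_s.  For U small enough
   |b_(s,q)| <= 1, whence F_q lies in sum_l V_l for every q, which a suitable
   choice of the V_l excludes for one nonzero F_q.

   For groups, a continuous multiadditive f into a Hausdorff group satisfies
   f(..., a x_i, ...) = f(..., a x_j, ...), first for rational a, then for all
   real a by density.  So f yields a multilinear map into the R-module of
   additive maps R -> F. *)

Require Import Defs.
From HB Require Import structures.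
From mathcomp Require Import all_boot all_order all_algebra.
From mathcomp Require Import all_classical all_reals all_analysis.

Set Implicit Arguments.
Unset Strict Implicit.
Unset Printing Implicit Defensive.

Import Order.TTheory GRing.Theory Num.Theory.
Import numFieldNormedType.Exports.
Local Open Scope classical_set_scope.
Local Open Scope ring_scope.

(** * Linear algebra *)

Lemma linear_fun (R : pzRingType) (U V : lmodType R) (f : U -> V) :
  linear f -> exists g : {linear U -> V}, f = g.
Proof.
move=> fL; pose g : {linear U -> V} := HB.pack f (GRing.isLinear.Build _ _ _ _ f fL).
by exists g.
Qed.

Section linear_algebra.
Variables (K : fieldType) (V : lmodType K).

Definition lin_indep r (y : 'I_r -> V) : Prop :=
  forall a : 'I_r -> K, \sum_s a s *: y s = 0 -> forall s, a s = 0.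

(** Zorn's lemma gives a subspace that contains [S] and is maximal among those avoiding [v]. By
    maximality it complements the line through [v], and [f] is the coordinate along [v]. *)
Lemma separating_functional (S : set V) (v : V) :
  S 0 -> (forall a x y, S x -> S y -> S (a *: x + y)) -> ~ S v ->
  exists f : {scalar V}, (forall x, S x -> f x = 0) /\ f v = 1.
Proof.
move=> S0 SL Sv.
(* The condition bears on the union of [A] with [S], so that it also holds for the union of the
   empty chain. *)
pose P (A : set V) := (forall a x y, (A `|` S) x -> (A `|` S) y ->
  (A `|` S) (a *: x + y)) /\ ~ (A `|` S) v.
have [A [[AL Av] Amax]] : exists A, P A /\ forall B, A `<` B -> ~ P B.
  apply: Zorn_bigcup => F FP Ftot; split=> [a x y|]; last first.
    by case=> [[X FX Xv]|//]; apply: (FP X FX).2; left.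
  have step X : F X -> (X `|` S) x -> (X `|` S) y ->
      ((\bigcup_(X in F) X) `|` S) (a *: x + y).
    move=> FX Xx Xy; have [Xa|Sa] := (FP X FX).1 a x y Xx Xy; last by right.
    by left; exists X.
  case=> [[X FX Xx]|Sx] [[Y FY Yy]|Sy].
  - have [XY|YX] := Ftot _ _ FX FY.
      by apply: (step Y) => //; left=> //; exact: XY.
    by apply: (step X) => //; left=> //; exact: YX.
  - by apply: (step X) => //; [left|right].
  - by apply: (step Y) => //; [right|left].
  - by right; exact: SL.
pose M := A `|` S.
have MD x y : M x -> M y -> M (x + y) by rewrite -[x in x + _]scale1r; exact: AL.
have M0 : M 0 by right.
have MZ a x : M x -> M (a *: x) by rewrite -[a *: x]addr0 => /AL; exact.
have decomp x : exists c, M (x - c *: v).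
  have [Mx|Mx] := pselect (M x); first by exists 0; rewrite scale0r subr0.
  (* The subspace spanned by [M] and [x] must contain [v] by maximality; solving the resulting
     equation for [x] gives the coordinate. *)
  pose B := [set z | exists2 m, M m & exists d, z = m + d *: x].
  have MB z : M z -> B z by move=> Mz; exists z => //; exists 0; rewrite scale0r addr0.
  have BSE : B `|` S = B by apply/setUidl => z Sz; apply: MB; right.
  have AB : A `<` B.
    split; first by move=> z Az; apply: MB; left.
    move=> BA; apply: Mx; left; apply: BA.
    by exists 0 => //; exists 1; rewrite scale1r add0r.
  have : ~ P B by exact: Amax.
  rewrite /P BSE => /not_andP[nL|].
    exfalso; apply: nL => a _ _ [m Mm [d ->]] [m' Mm' [d' ->]].
    exists (a *: m + m'); first exact: AL.
    by exists (a * d + d'); rewrite scalerDr scalerA scalerDl addrACA.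
  move=> /contrapT[m Mm [d vE]].
  have d0 : d != 0.
    by apply/eqP => d0; apply: Av; rewrite vE d0 scale0r addr0.
  exists d^-1; rewrite vE scalerDr scalerA mulVf// scale1r opprD addrCA subrr addr0.
  by rewrite -scaleNr; exact: MZ.
pose f x := sval (cid (decomp x)).
have fP x : M (x - f x *: v) by rewrite /f; case: cid.
have funiq x c : M (x - c *: v) -> f x = c.
  move=> Mc; apply/eqP; rewrite -subr_eq0; apply/negPn/negP => fc.
  apply: Av; have := @MZ (f x - c)^-1 ((f x - c) *: v).
  rewrite scalerA mulVf// scale1r; apply.
  have -> : (f x - c) *: v = (-1) *: (x - f x *: v) + (x - c *: v).
    by rewrite scaleN1r opprB scalerBl addrA subrK.
  by apply: AL; [exact: fP|exact: Mc].
have fL : scalar f.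
  move=> a x y; apply: funiq; rewrite scalerDl -scalerA opprD addrACA -scalerBr.
  by apply: AL; exact: fP.
pose g : {scalar V} := HB.pack f (GRing.isLinear.Build _ _ _ _ f fL).
exists g; split=> [x Sx|]; apply: funiq; first by rewrite scale0r subr0; right.
by rewrite scale1r subrr.
Qed.

(** By independence, the span [S] of the other members misses [y s], so the two can be separated. *)
Lemma dual_functional r (y : 'I_r -> V) (s : 'I_r) : lin_indep y ->
  exists f : {scalar V}, forall t, f (y t) = (t == s)%:R.
Proof.
move=> yfree.
pose S := [set x | exists2 a : 'I_r -> K, a s = 0 & x = \sum_t a t *: y t].
have [|||f [fS fs]] := @separating_functional S (y s).
- by exists (fun=> 0) => //; rewrite big1// => t _; rewrite scale0r.
- move=> c _ _ [a as0 ->] [b bs0 ->]; exists (fun t => c * a t + b t).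
    by rewrite as0 bs0 mulr0 addr0.
  rewrite scaler_sumr -big_split/=; apply: eq_bigr => t _.
  by rewrite scalerA scalerDl.
- move=> [a as0 yE].
  have : \sum_t ((t == s)%:R - a t) *: y t = 0.
    rewrite (eq_bigr (fun t => (t == s)%:R *: y t - a t *: y t)); last first.
      by move=> t _; rewrite scalerBl.
    rewrite sumrB -yE (bigD1 s)//= eqxx scale1r big1 ?addr0 ?subrr// => t /negbTE ->.
    by rewrite scale0r.
  move=> /yfree/(_ s); rewrite eqxx as0 subr0 => /eqP; rewrite oner_eq0.
  by [].
exists f => t; have [->//|ts] := eqVneq t s.
apply: fS; exists (fun t' => (t' == t)%:R); first by rewrite eq_sym (negbTE ts).
by rewrite (bigD1 t)//= eqxx scale1r big1 ?addr0// => t' /negbTE ->; rewrite scale0r.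
Qed.

Lemma lin_indep_inj k r (y : 'I_k -> V) (g : 'I_r -> 'I_k) :
  lin_indep (y \o g) -> injective g.
Proof.
move=> yfree s t gst; apply/eqP/negPn/negP => st.
have /yfree/(_ s) : \sum_i ((i == s)%:R - (i == t)%:R) *: (y \o g) i = 0.
  rewrite (eq_bigr (fun i => (i == s)%:R *: y (g i) - (i == t)%:R *: y (g i))).
    rewrite sumrB (bigD1 s)//= eqxx scale1r big1 ?addr0; last first.
      by move=> i /negbTE ->; rewrite scale0r.
    rewrite (bigD1 t)//= eqxx scale1r big1 ?addr0 ?gst ?subrr// => i /negbTE ->.
    by rewrite scale0r.
  by move=> i _; rewrite scalerBl.
by rewrite eqxx (negbTE st) subr0 => /eqP; rewrite oner_eq0.
Qed.

(** A longest independent subfamily spans: putting any [y l] in front of it creates a relation whose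
    leading coefficient cannot vanish. *)
Lemma lin_indep_extraction k (y : 'I_k -> V) :
  exists r (g : 'I_r -> 'I_k) (c : 'I_k -> 'I_r -> K),
    lin_indep (y \o g) /\ forall l, y l = \sum_s c l s *: y (g s).
Proof.
pose P r := `[< exists g : 'I_r -> 'I_k, lin_indep (y \o g) >].
have P0 : exists r, P r.
  have g0 : 'I_0 -> 'I_k by case.
  by exists 0%N; apply/asboolP; exists g0 => a _ [].
have Pk r : P r -> (r <= k)%N.
  move=> /asboolP[g /lin_indep_inj g_inj].
  by rewrite -(card_ord r) -[leqRHS](card_ord k); exact: leq_card g_inj.
have [r /asboolP[g gfree] rmax] := ex_maxnP P0 Pk.
suff /choice[c cP] : forall l, exists c, y l = \sum_s c s *: y (g s).
  by exists r, g, c.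
move=> l.
pose g' (i : 'I_r.+1) := if unlift ord0 i is Some s then g s else l.
have /existsNP[a /not_implyP[]] : ~ lin_indep (y \o g').
  move=> g'free; have : P r.+1 by apply/asboolP; exists g'.
  by move=> /rmax; rewrite ltnn.
rewrite big_ord_recl /= /g' unlift_none.
under eq_bigr do rewrite liftK.
move=> a0 ane.
have a00 : a ord0 != 0.
  apply/eqP => a00; apply: ane => s.
  have := a0; rewrite a00 scale0r add0r => /gfree aS.
  by case: (unliftP ord0 s) => [j ->|->]; rewrite ?aS.
exists (fun s => - (a ord0)^-1 * a (lift ord0 s)).
have /(congr1 ( *:%R (a ord0)^-1)) := a0.
rewrite scalerDr scalerA mulVf// scale1r scaler0 => /eqP; rewrite addr_eq0 => /eqP ->.
rewrite scaler_sumr -sumrN; apply: eq_bigr => s _.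
by rewrite scalerA -scaleNr mulNr.
Qed.

End linear_algebra.

(** Expand along row [s]: its cofactors involve only the other rows, hence are those of the identity
    matrix. *)
Lemma det_replace_row (K : comNzRingType) r (B : 'M[K]_r) (s : 'I_r) :
  (forall i, i != s -> row i B = row i 1%:M) -> \det B = B s s.
Proof.
move=> BE.
have cofE j : cofactor B s j = (j == s)%:R.
  transitivity ((\adj (1%:M : 'M[K]_r)) j s).
    rewrite [RHS]mxE /cofactor; congr (_ * \det _).
    apply/matrixP => i t; rewrite !mxE.
    have /BE/rowP/(_ (lift j t)) : lift s i != s by rewrite eq_sym neq_lift.
    by rewrite !mxE.
  by rewrite -[\adj _]mul1mx mul_mx_adj det1 mxE.
rewrite (expand_det_row _ s) (bigD1 s)//= cofE eqxx mulr1 big1 ?addr0// => j js.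
by rewrite cofE (negbTE js) mulr0.
Qed.

(* The subfamily is chosen with coordinate determinant of maximal modulus;
   Cramer's rule then bounds the coefficients. *)
Lemma bounded_extraction (K : realFieldType) (V : lmodType K) k (y : 'I_k -> V) :
  exists r (g : 'I_r -> 'I_k) (c : 'I_k -> 'I_r -> K),
    [/\ lin_indep (y \o g), forall l, y l = \sum_s c l s *: y (g s) &
        forall l s, `|c l s| <= 1].
Proof.
have [r [g0 [c0 [g0free yE]]]] := lin_indep_extraction y.
pose C := \matrix_(l < k, s < r) c0 l s.
pose G := finfun g0.
pose D (g : {ffun 'I_r -> 'I_k}) := \det (rowsub g C).
(* The initial subfamily has determinant 1, so the maximal modulus is at least 1 and [A] is
   invertible. *)
have C0 : rowsub G C = 1%:M.
  apply/matrixP => i j; rewrite !mxE ffunE.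
  have /g0free : \sum_s (c0 (g0 i) s - (i == s)%:R) *: (y \o g0) s = 0.
    rewrite (eq_bigr (fun s => c0 (g0 i) s *: y (g0 s) - (i == s)%:R *: y (g0 s))).
      rewrite sumrB -yE (bigD1 i)//= eqxx scale1r big1 ?addr0 ?subrr// => s.
      by rewrite eq_sym => /negbTE ->; rewrite scale0r.
    by move=> s _; rewrite scalerBl.
  by move=> /(_ j)/eqP; rewrite subr_eq0 => /eqP.
have [g _ gmax] := @arg_maxP _ _ _ G predT (fun g => `|D g|) isT.
set A := rowsub g C.
have A1 : 1 <= `|\det A|.
  by apply: le_trans (gmax G isT); rewrite /D C0 det1 normr1.
have Au : A \in unitmx.
  by rewrite unitmxE unitfE; apply: contraTneq A1 => ->; rewrite normr0 ler10.
(* Row [l] of [M] holds the coordinates of [y l] in the maximizing subfamily. *)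
pose M := C *m invmx A.
have CE : C = M *m A by rewrite /M mulmxKV.
have AE i : y (g i) = \sum_j A i j *: y (g0 j).
  by rewrite [LHS]yE; apply: eq_bigr => j _; rewrite !mxE.
exists r, g, (fun l s => M l s); split.
- move=> a a0.
  have /g0free aA : \sum_j ((\row_s a s) *m A) 0 j *: (y \o g0) j = 0.
    rewrite -[RHS]a0; under [RHS]eq_bigr do rewrite /= AE scaler_sumr.
    rewrite exchange_big/=; apply: eq_bigr => j _.
    rewrite mxE scaler_suml; apply: eq_bigr => s _.
    by rewrite scalerA mxE.
  have : (\row_s a s) *m A = 0 by apply/rowP => j; rewrite aA mxE.
  move=> /(congr1 (mulmx^~ (invmx A))); rewrite mulmxK// mul0mx => /rowP aE s.
  by have := aE s; rewrite !mxE.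
- move=> l; rewrite [LHS]yE.
  transitivity (\sum_j (M *m A) l j *: y (g0 j)).
    by apply: eq_bigr => j _; rewrite -CE mxE.
  under [RHS]eq_bigr do rewrite AE scaler_sumr.
  rewrite exchange_big/=; apply: eq_bigr => j _.
  rewrite mxE scaler_suml; apply: eq_bigr => s _.
  by rewrite scalerA.
- move=> l s.
  (* Exchanging the [s]-th member for [y l] multiplies the determinant by [M l s]; maximality bounds
     this factor by 1. *)
  pose h := [ffun i => if i == s then l else g i].
  have hE : rowsub h C = rowsub h M *m A by rewrite {1}CE mul_rowsub_mx.
  have MA : rowsub g M = 1%:M.
    by rewrite /M -mul_rowsub_mx -/A mulmxV.
  have : `|D h| <= `|\det A| by exact: gmax.
  rewrite /D hE det_mulmx normrM (@det_replace_row _ _ _ s) => [|i is_]; last first.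
    apply/rowP => j; rewrite !mxE ffunE (negbTE is_).
    by have /matrixP/(_ i j) := MA; rewrite !mxE.
  by rewrite mxE ffunE eqxx ger_pMl// (lt_le_trans ltr01).
Qed.

(** * Topological groups and vector spaces *)

Section topological_zmodule.
Variable E : topologicalZmodType.

Lemma nbhs_add2 (x y : E) (A : set E) : nbhs (x + y) A ->
  exists2 U, nbhs x U & exists2 V, nbhs y V & forall u v, U u -> V v -> A (u + v).
Proof.
move=> /(@add_continuous E (x, y)) [[U V] [/= Ux Vy] UVA].
by exists U => //; exists V => // u v Uu Vv; exact: (UVA (u, v) (conj Uu Vv)).
Qed.

Lemma nbhs_half (U : set E) : nbhs 0 U ->
  exists2 V, nbhs (0 : E) V & forall x y, V x -> V y -> U (x + y).
Proof.
move=> U0; have /nbhs_add2[V V0 [W W0 VWU]] : nbhs (0 + 0 : E) U by rewrite addr0.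
exists (V `&` W); first exact: filterI.
by move=> x y [Vx _] [_ Wy]; exact: VWU Vx Wy.
Qed.

Lemma nbhs_translate (x : E) (U : set E) : nbhs (0 : E) U ->
  \forall y \near x, U (y - x).
Proof.
move=> U0; have /nbhs_add2[V Vx [W Wx VWU]] : nbhs (x - x) U by rewrite subrr.
by apply: filterS Vx => y Vy; apply: VWU => //; exact: nbhs_singleton.
Qed.

Lemma nbhs_translate0 (x : E) (A : set E) : nbhs x A ->
  \forall u \near (0 : E), A (x + u).
Proof.
move=> Ax; have /nbhs_add2[V Vx [W W0 VWA]] : nbhs (x + 0) A by rewrite addr0.
by apply: filterS W0 => u Wu; apply: VWA => //; exact: nbhs_singleton.
Qed.

(** Repeated halving gives neighbourhoods [W k] with the sum of two copies of [W k.+1] inside [W k].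
    By induction from the tail, a sum with terms in [W 1], [W 2], ... stays in [W 0]. *)
Lemma nbhs_sum (U : set E) : nbhs (0 : E) U ->
  exists2 V : nat -> set E, (forall k, nbhs (0 : E) (V k)) &
    forall k (y : 'I_k -> E), (forall l : 'I_k, V l (y l)) -> U (\sum_(l < k) y l).
Proof.
move=> U0.
pose P (A : {A : set E | nbhs (0 : E) A}) (B : {A : set E | nbhs (0 : E) A}) :=
  forall x y, sval B x -> sval B y -> sval A (x + y).
have /choice[h hP] : forall A, exists B, P A B.
  by move=> [A A0]; have [B B0 AB] := nbhs_half A0; exists (exist _ B B0).
pose W k := iter k h (exist _ U U0).
have W0 k : nbhs (0 : E) (sval (W k)) by case: (W k).
exists (fun k => sval (W k.+1)) => // k.
suff gen m (y : 'I_k -> E) : (forall l : 'I_k, sval (W (m + l).+1) (y l)) ->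
    sval (W m) (\sum_(l < k) y l) by exact: (gen 0%N).
elim: k m y => [m y _|k IHk m y yV].
  by rewrite big_ord0; exact: nbhs_singleton (W0 m).
rewrite big_ord_recl; apply: hP; first by have := yV ord0; rewrite addn0.
by apply: (IHk m.+1) => l; have := yV (lift ord0 l); rewrite lift0 addnS.
Qed.

(** A point [z] with [z - x] and [y - z] both in [V] would put [y - x] into [U]. *)
Lemma hausdorff_separate0 :
  (forall x : E, x <> 0 -> exists2 U, nbhs (0 : E) U & ~ U x) ->
  hausdorff_space E.
Proof.
move=> sep x y xy; apply/eqP/negPn/negP => /eqP xNy.
have [|U /nbhs_half[V V0 VU] Uyx] := sep (y - x).
  by move/eqP; rewrite subr_eq0 => /eqP/esym.
have N0 : \forall u \near (0 : E), V (- u).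
  have : nbhs (- 0 : E) V by rewrite oppr0.
  by move=> /(@opp_continuous E 0).
have [z [/= Az Bz]] := xy _ _ (nbhs_translate x V0) (nbhs_translate y N0).
apply: Uyx; rewrite -(subrKA z) addrC -(opprB z y); exact: VU.
Qed.

Lemma hausdorff_nbhs0 (x : E) : hausdorff_space E -> x <> 0 ->
  exists2 U, nbhs (0 : E) U & ~ U x.
Proof.
move=> hE x0; exists (~` [set x]); last by apply.
apply: open_nbhs_nbhs; split; last by move=> /esym.
exact/closed_openC/accessible_closed_set1/hausdorff_accessible.
Qed.

End topological_zmodule.

(** * Boxes as neighbourhoods in finite products *)

Section product_nbhs.
Variables (I : finType) (K : I -> topologicalType).

Lemma nbhs_box (x : prod_topology K) (A : forall i, set (K i)) :
  (forall i, nbhs (x i) (A i)) -> nbhs x [set y | forall i, A i (y i)].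
Proof.
move=> Ax; apply: (@filter_forall _ I (fun i y => A i (y i)) (nbhs x)) => i.
exact: (@proj_continuous _ K i x _ (Ax i)).
Qed.

(** The sets containing a box around [x] form a filter. The product topology is a supremum of
    initial topologies, so convergence of this filter is tested one coordinate at a time. *)
Lemma box_nbhs (x : prod_topology K) (W : set (prod_topology K)) : nbhs x W ->
  exists2 A : forall i, set (K i), (forall i, nbhs (x i) (A i)) &
    forall y, (forall i, A i (y i)) -> W y.
Proof.
pose F : set_system (prod_topology K) := [set W |
  exists2 A : forall i, set (K i), (forall i, nbhs (x i) (A i)) &
    forall y, (forall i, A i (y i)) -> W y].
have FF : Filter F.
  split; first by exists (fun=> setT) => // i; exact: filterT.
    move=> P Q [A Ax AP] [B Bx BQ]; exists (fun i => A i `&` B i).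
      by move=> i; exact: filterI.
    by move=> y ABy; split; [apply: AP|apply: BQ] => i; have [] := ABy i.
  by move=> P Q PQ [A Ax AP]; exists A => // y /AP; exact: PQ.
suff : F --> x by apply.
apply/cvg_sup => i A [_ [[B oB <-] Bx BA]].
(* This box constrains coordinate [i] only; for other [j] the condition is vacuous. *)
exists (fun j => [set z | forall e : j = i, B (ecast j (K j) e z)]).
  move=> j; have [ji|/eqP ji] := eqVneq j i; last first.
    by apply: filterS filterT => z _ /[dup] /ji.
  subst j; apply: filterS (open_nbhs_nbhs (conj oB Bx)) => z Bz e.
  by rewrite (eq_irrelevance e erefl).
by move=> y /(_ i)/(_ erefl) /= By; apply: BA.
Qed.

End product_nbhs.

Lemma continuous_big_sum (X : topologicalType) (E : topologicalZmodType)
    (I : Type) (s : seq I) (f : I -> X -> E) :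
  (forall i, continuous (f i)) -> continuous (fun x => \sum_(i <- s) f i x).
Proof.
move=> fC x; elim: s => [|i s IHs].
  by under eq_fun do rewrite big_nil; exact: cvg_cst.
under eq_fun do rewrite big_cons.
apply: (@continuous_comp _ _ _ (fun x => (f i x, \sum_(j <- s) f j x))
  (fun z : E * E => z.1 + z.2)); last exact: add_continuous.
exact: cvg_pair (fC i x) IHs.
Qed.

Section topological_lmodule.
Variables (R : realType) (E : topologicalLmodType R).

Lemma lmod_scaler_continuous (a : R) : continuous (fun x : E => a *: x).
Proof.
move=> x; apply: (@continuous_comp _ _ _ (fun x : E => (a : R^o, x))
  (fun z : R^o * E => z.1 *: z.2)); last exact: scale_continuous.
exact: cvg_pair (cvg_cst _) cvg_id.
Qed.

Lemma lmod_scalel_continuous (x : E) : continuous (fun a : R^o => a *: x).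
Proof.
move=> a; apply: (@continuous_comp _ _ _ (fun a : R^o => (a, x))
  (fun z : R^o * E => z.1 *: z.2)); last exact: scale_continuous.
exact: cvg_pair cvg_id (cvg_cst _).
Qed.

Lemma nbhs_absorbing (x : E) (U : set E) : nbhs (0 : E) U ->
  \forall a \near (0 : R^o), U (a *: x).
Proof.
move=> U0; have : nbhs ((0 : R^o) *: x) U by rewrite scale0r.
exact: lmod_scalel_continuous.
Qed.

(** The balanced core of [U] works: joint continuity of scaling at zero sends scalars below [e]
    times [V] into [U], and rescaling [V] by [e / 2] admits all scalars of modulus at most 1. *)
Lemma balanced_nbhs (U : set E) : nbhs (0 : E) U ->
  exists2 V, nbhs (0 : E) V & balanced V /\ V `<=` U.
Proof.
move=> U0; have : nbhs ((0 : R^o) *: (0 : E)) U by rewrite scale0r.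
move=> /(@scale_continuous R E (0, 0)) [[A V] [/= /nbhs_ballP[e /= e0 eA] V0] AVU].
have e2 : e / 2 != 0 by rewrite gt_eqF// divr_gt0.
exists [set x | forall a, `|a| <= 1 -> U (a *: x)]; last split.
- have Ve : \forall x \near (0 : E), V ((e / 2)^-1 *: x).
    by apply: lmod_scaler_continuous; rewrite scaler0.
  apply: filterS Ve => x Vx a a1.
  have -> : a *: x = (a * (e / 2)) *: ((e / 2)^-1 *: x).
    by rewrite scalerA mulfK.
  apply: (AVU (_, _)); split=> //=; apply: eA; rewrite /ball/= sub0r normrN normrM.
  rewrite (@le_lt_trans _ _ (e / 2))//; last by rewrite ltr_pdivrMr// ltr_pMr// ltr1n.
  by rewrite (gtr0_norm (divr_gt0 _ _))// ler_piMl// divr_ge0// ltW.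
- move=> a x a1 Ux b b1; rewrite scalerA; apply: Ux.
  by rewrite normrM mulr_ile1.
- by move=> x /(_ 1); rewrite normr1 scale1r; exact.
Qed.

Lemma balanced_nbhs_sum (U : set E) : nbhs (0 : E) U ->
  exists2 V : nat -> set E, (forall k, nbhs (0 : E) (V k) /\ balanced (V k)) &
    forall k (y : 'I_k -> E), (forall l : 'I_k, V l (y l)) -> U (\sum_(l < k) y l).
Proof.
move=> /nbhs_sum[V V0 VU].
have /choice[W WP] : forall k, exists W,
    [/\ nbhs (0 : E) W, balanced W & W `<=` V k].
  by move=> k; have [W W0 [Wb WV]] := balanced_nbhs (V0 k); exists W.
exists W => [k|k y Wy]; first by have [] := WP k.
by apply: VU => l; have [_ _] := WP l; apply; exact: Wy.
Qed.

(** [S i] collects the combinations with coefficients in [-1, 1] and [i]-th coefficient 1. It is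
    compact, hence closed, and misses 0 by independence. A combination with some coefficient beyond
    1 in modulus, divided by its largest one, falls into some [S j]. *)
Lemma bounded_coordinates m (y : 'I_m -> E) : hausdorff_space E -> lin_indep y ->
  exists2 U, nbhs (0 : E) U & forall b : 'I_m -> R, U (\sum_i b i *: y i) ->
    forall i, `|b i| <= 1.
Proof.
move=> hE yfree.
pose B (i j : 'I_m) : set R := if j == i then [set 1] else [set` `[-1, 1]%R].
pose f (b : prod_topology (fun _ : 'I_m => R^o)) := \sum_i b i *: y i.
pose S (i : 'I_m) := f @` [set b | forall j, B i j (b j)].
have fC : continuous f.
  apply: continuous_big_sum => i b.
  apply: (@continuous_comp _ _ _ (fun b : prod_topology (fun _ : 'I_m => R^o) => b i)
    (fun a : R^o => a *: y i)); last exact: lmod_scalel_continuous.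
  exact: (@proj_continuous _ (fun _ : 'I_m => R^o) i b).
have S0 (i : 'I_m) : nbhs (0 : E) (~` S i).
  apply: open_nbhs_nbhs; split.
    apply: closed_openC; apply: compact_closed => //.
    apply: (@continuous_compact (prod_topology (fun _ : 'I_m => R^o)) E f).
      exact: continuous_subspaceT.
    apply: (@tychonoff _ (fun _ : 'I_m => R^o)) => j; rewrite /B.
    by case: ifP => _; [exact: compact_set1|exact: segment_compact].
  move=> [b Bb /yfree/(_ i) bi].
  by have := Bb i; rewrite /B eqxx bi /= => /eqP; rewrite eq_sym oner_eq0.
have [V V0 [Vb VS]] := balanced_nbhs (filter_forall _ S0).
exists V => // b Vy i; rewrite leNgt; apply/negP => bi.
have [j _ jmax] := @arg_maxP _ _ _ i predT (fun i => `|b i|) isT.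
have bj : 1 < `|b j| by exact: lt_le_trans bi (jmax i isT).
have bj0 : b j != 0 by rewrite -normr_gt0 (lt_trans _ bj).
apply: (VS ((b j)^-1 *: \sum_i b i *: y i) _ j).
  by apply: Vb Vy; rewrite normfV invf_le1 ?(lt_trans _ bj)// ltW.
exists (fun i => (b j)^-1 * b i); last first.
  by rewrite /f scaler_sumr; apply: eq_bigr => l _; rewrite scalerA.
move=> l; rewrite /B; case: eqP => [->|_]; first by rewrite /= mulVf.
rewrite /= in_itv/= -ler_norml normrM normfV ler_pdivrMl ?(lt_trans _ bj)//.
by rewrite mulr1; exact: jmax.
Qed.

End topological_lmodule.

(** * Vector topologies generated by a basis at zero *)

Section vector_topology_of_basis.
Variables (R : realType) (T : lmodType R) (B : set_system T).
Hypothesis BI : forall U V, B U -> B V -> exists2 W, B W & W `<=` U `&` V.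
Hypothesis BD : forall U, B U ->
  exists2 V, B V & forall x y, V x -> V y -> U (x + y).
Hypothesis Bbal : forall U, B U -> balanced U.
Hypothesis Babs : forall U x, B U -> exists2 e : R, 0 < e & U (e *: x).
Hypothesis B0 : B !=set0.

Let U0 U : B U -> U 0.
Proof.
by move=> BU; have [e _] := Babs 0 BU; rewrite scaler0.
Qed.

Let op : set_system T := [set G | forall x, G x ->
  exists2 U, B U & forall u, U u -> G (x + u)].

Let opT : op setT.
Proof. by move=> x _; have [U BU] := B0; exists U. Qed.

Let opI : setI_closed op.
Proof.
move=> G H oG oH x [/oG[U BU UG] /oH[V BV VH]].
have [W BW WUV] := BI BU BV.
by exists W => // w /WUV[Uw Vw]; split; [exact: UG|exact: VH].
Qed.

Let op_bigcup (I : Type) (G : I -> set T) :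
  (forall i, op (G i)) -> op (\bigcup_i G i).
Proof.
move=> oG x [i _ /oG[U BU UG]]; exists U => // u Uu.
by exists i => //; exact: UG.
Qed.

Definition basis_topology : topology T := Topology opT opI op_bigcup.

Local Notation TO := (topologized basis_topology).

Lemma nbhs_basis_topology (x : TO) (A : set T) :
  nbhs x A <-> exists2 U, B U & forall u, U u -> A (x + u).
Proof.
split=> [[G [oG Gx GA]]|[U BU UA]].
  by have [U BU UG] := oG x Gx; exists U => // u /UG; exact: GA.
(* This is the interior of [A]; halving the basic sets shows that it is open. *)
exists [set y | exists2 V, B V & forall v, V v -> A (y + v)]; split.
- move=> y [V BV VA]; have [W BW WV] := BD BV.
  exists W => // w Ww; exists W => // v Wv; rewrite -addrA; apply: VA.
  exact: WV.
- by exists U.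
- by move=> y [V BV VA]; rewrite -[y]addr0; apply: VA; exact: U0.
Qed.

(** Each halving doubles the scalars that are allowed, and [k] of them suffice once [c] is at most
    [2 ^+ k]. *)
Let expand (c : R) U : B U ->
  exists2 V, B V & forall a v, `|a| <= c -> V v -> U (a *: v).
Proof.
have ck := ltW (upper_nthrootP (leqnn (Num.bound c))).
move: (Num.bound c) ck => k ck; elim: k => [|k IHk] in c ck U *; move=> BU.
  exists U => // a v ac Uv; apply: (Bbal BU) Uv.
  exact: le_trans ac ck.
have [V BV VU] := BD BU.
have [|W BW WV] := IHk (c / 2) _ V BV; first by rewrite ler_pdivrMr// -exprSr.
exists W => // a v ac Wv.
have -> : a *: v = (a / 2) *: v + (a / 2) *: v by rewrite -scalerDl -splitr.
have a2 : `|a / 2| <= c / 2.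
  by rewrite normrM normfV (gtr0_norm (ltr0n _ 2)) ler_pM2r// invr_gt0.
by apply: VU; apply: WV.
Qed.

Lemma basis_topology_vector : is_vector_topology basis_topology.
Proof.
split.
- move=> [x y] A /nbhs_basis_topology[U BU UA].
  have [V BV VU] := BD BU.
  exists ([set z | V (z - x)], [set z | V (z - y)]).
    by split; apply/nbhs_basis_topology; exists V => // v Vv /=; rewrite addrC addKr.
  move=> [z w] [/= Vz Vw]; have := UA _ (VU _ _ Vz Vw).
  by rewrite addrACA !(addrC (_ : T) (_ - _)) !subrK.
- move=> [a x] A /nbhs_basis_topology[U BU UA].
  have [V BV VU] := BD BU.
  have [W BW WV] := @expand (`|a| + 1) V BV.
  have [e e0 Vx] := Babs x BV.
  (* The bound by [e] lets [e *: x] absorb [(b - a) *: x]; the bound by 1 keeps the modulus of [b]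
     below [|a| + 1]. *)
  pose d := Order.min e 1.
  exists ([set b | `|b - a| < d], [set z | W (z - x)]).
    split=> /=.
      apply/nbhs_ballP; exists d => /=; first by rewrite lt_min e0 ltr01.
      by move=> b; rewrite /ball/= distrC.
    by apply/nbhs_basis_topology; exists W => // v Vv /=; rewrite addrC addKr.
  move=> [b z] [/= bd Wz].
  have -> : b *: z = a *: x + ((b - a) *: x + b *: (z - x)).
    by rewrite scalerBl scalerBr [X in _ + X]addrC subrKA addrC subrK.
  apply: UA; apply: VU.
    have -> : (b - a) *: x = ((b - a) / e) *: (e *: x).
      by rewrite scalerA divfK// gt_eqF.
    apply: (Bbal BV) Vx; rewrite normrM normfV (gtr0_norm e0).
    by rewrite ler_pdivrMr// mul1r ltW// (lt_le_trans bd)// ge_min lexx.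
  apply: WV Wz; rewrite -[b](subrK a) addrC (le_trans (ler_normD _ _))// lerD2l.
  by rewrite ltW// (lt_le_trans bd)// ge_min lexx orbT.
Qed.

End vector_topology_of_basis.

(** * Multilinear maps and algebraic tensor products *)

Section dfwith_lemmas.
Variables (I : eqType) (K : I -> Type).
Implicit Types x : forall i, K i.

Lemma dfwith_id x i : dfwith x i (x i) = x.
Proof. by apply/functional_extensionality_dep => j; case: dfwithP. Qed.

Lemma dfwith_dfwith x i (y z : K i) : dfwith (dfwith x i y) i z = dfwith x i z.
Proof.
apply/functional_extensionality_dep => j.
have [<-|ij] := eqVneq i j; first by rewrite !dfwithin.
by rewrite (dfwithout _ _ ij) (dfwithout _ _ ij) (dfwithout _ _ ij).
Qed.

Lemma dfwithC x i j (y : K i) (z : K j) : i != j ->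
  dfwith (dfwith x i y) j z = dfwith (dfwith x j z) i y.
Proof.
move=> ij; apply/functional_extensionality_dep => k.
have [<-|ik] := eqVneq i k.
  by rewrite dfwithin dfwithout 1?eq_sym// dfwithin.
rewrite [RHS](dfwithout _ _ ik).
have [<-|jk] := eqVneq j k; first by rewrite !dfwithin.
by rewrite (dfwithout _ _ jk) (dfwithout _ _ ik) (dfwithout _ _ jk).
Qed.

End dfwith_lemmas.

Section multiadditive.
Variables (n : nat) (V : 'I_n -> zmodType) (W : zmodType).
Variable f : (forall i, V i) -> W.
Hypothesis fA : multiadditive f.

Lemma multiadditive_sum x i (I : Type) (s : seq I) (y : I -> V i) :
  f (dfwith x i (\sum_(k <- s) y k)) = \sum_(k <- s) f (dfwith x i (y k)).
Proof.
have f0 : f (dfwith x i 0) = 0.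
  by apply: (addrI (f (dfwith x i 0))); rewrite -fA !addr0.
elim: s => [|k s IHs]; first by rewrite !big_nil.
by rewrite !big_cons fA IHs.
Qed.

Lemma multiadditive0 x i : x i = 0 -> f x = 0.
Proof.
move=> xi; rewrite -(dfwith_id x i) xi.
by have := @multiadditive_sum x i nat [::] (fun=> 0); rewrite !big_nil.
Qed.

Lemma multiadditiveB x i y z :
  f (dfwith x i (y - z)) = f (dfwith x i y) - f (dfwith x i z).
Proof. by apply/eqP; rewrite eq_sym subr_eq -fA subrK. Qed.

End multiadditive.

Section multilinear.
Variables (R : pzRingType) (n : nat) (V : 'I_n -> lmodType R) (W : lmodType R).
Variable f : (forall i, V i) -> W.
Hypothesis fL : multilinear f.

Lemma multilinear_additive : multiadditive f.
Proof. by move=> x i y z; have := @fL x i 1 y z; rewrite /= !scale1r. Qed.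

Lemma multilinearZ x i a y : f (dfwith x i (a *: y)) = a *: f (dfwith x i y).
Proof.
have := @fL x i a y 0; rewrite /= addr0 => ->.
rewrite [X in _ + X](@multiadditive0 _ _ _ _ multilinear_additive _ i).
  by rewrite addr0.
by rewrite dfwithin.
Qed.

End multilinear.

Lemma multilinear_scale (R : comPzRingType) n (V : 'I_n -> lmodType R)
    (W : lmodType R) (f : (forall i, V i) -> W) (a : 'I_n -> R) x :
  multilinear f -> f (fun i => a i *: x i) = (\prod_i a i) *: f x.
Proof.
move=> fL.
(* Slots are scaled one at a time; [s] lists those already treated. *)
suff gen (s : seq 'I_n) : uniq s ->
    f (fun i => if i \in s then a i *: x i else x i) = (\prod_(i <- s) a i) *: f x.
  have := gen (index_enum _) (index_enum_uniq _); rewrite -[RHS]/((\prod_i a i) *: f x) => <-.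
  congr f; apply/functional_extensionality_dep => i.
  by rewrite mem_index_enum.
elim: s => [_|i s IHs /= /andP[iNs us]].
  by rewrite big_nil scale1r; congr f; apply/functional_extensionality_dep.
rewrite big_cons -scalerA -IHs// -(dfwith_id (fun j => if j \in s then _ else _) i).
rewrite -multilinearZ//; congr f; apply/functional_extensionality_dep => j.
rewrite in_cons; have [->|ji] := eqVneq j i.
  by rewrite dfwithin (negbTE iNs).
by rewrite dfwithout// eq_sym.
Qed.

(* The R-module of additive maps R -> F, with (a *: h) s = h (s * a), reduces
   additive factorizations through a tensor product to linear ones. *)
Section additive_functions.
Variables (R : pzRingType) (F : zmodType).

Definition additive_pred : {pred R -> F} := fun h => `[< {morph h : x y / x + y} >].

Let additive_zmod_closed : zmod_closed additive_pred.
Proof.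
split=> [|h k /asboolP hA /asboolP kA]; apply/asboolP => x y /=.
  by rewrite addr0.
by rewrite -[LHS]/(h (x + y) - k (x + y)) hA kA opprD addrACA.
Qed.

HB.instance Definition _ :=
  GRing.isZmodClosed.Build (R -> F) additive_pred additive_zmod_closed.

Record additive_fun := AdditiveFun {
  additive_fun_val :> R -> F ;
  _ : additive_fun_val \in additive_pred }.

HB.instance Definition _ := [isSub for additive_fun_val].
HB.instance Definition _ := [Choice of additive_fun by <:].
HB.instance Definition _ := [SubChoice_isSubZmodule of additive_fun by <:].

Lemma additive_funD (h : additive_fun) : {morph h : x y / x + y}.
Proof. by case: h => h /= /asboolP. Qed.

Let scale_subproof (a : R) (h : additive_fun) : (fun s => h (s * a)) \in additive_pred.
Proof. by apply/asboolP => x y; rewrite mulrDl additive_funD. Qed.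

Let scale a h := AdditiveFun (scale_subproof a h).

Let scaleA a b h : scale a (scale b h) = scale (a * b) h.
Proof. by apply/val_inj/funext => s /=; rewrite mulrA. Qed.

Let scale1 : left_id 1 scale.
Proof. by move=> h; apply/val_inj/funext => s /=; rewrite mulr1. Qed.

Let scaleDr : right_distributive scale +%R.
Proof. by move=> a h k; apply/val_inj/funext. Qed.

Let scaleDl h : {morph scale^~ h : a b / a + b}.
Proof.
by move=> a b; apply/val_inj/funext => s /=; rewrite mulrDr additive_funD.
Qed.

HB.instance Definition _ := GRing.Zmodule_isLmodule.Build R additive_fun
  scaleA scale1 scaleDr scaleDl.

End additive_functions.

Section tensor_product.
Variables (R : fieldType) (n : nat) (V : 'I_n -> lmodType R) (i0 : 'I_n).
Variables (T : lmodType R) (tau : (forall i, V i) -> T).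
Hypothesis tauT : is_tensor_product tau.

(** If sums of pure tensors missed [t], a functional killing all of them but not [t] would be a
    second factorization of the zero map. *)
Lemma tensor_span (t : T) :
  exists k (x : 'I_k -> forall i, V i), t = \sum_(l < k) tau (x l).
Proof.
pose S := [set t | exists s, t = \sum_(x <- s) tau x].
suff /contrapT[s ->] : ~ ~ S t.
  exists (size s), (fun l => nth (fun=> 0) s l).
  by rewrite (big_nth (fun=> 0)) big_mkord.
move=> St.
have [||f [fS ft]] := separating_functional _ _ St.
- by exists [::]; rewrite big_nil.
- move=> a _ _ [s ->] [s' ->].
  (* Slot [i0] absorbs the scalar, so sums without coefficients already form a subspace. *)
  pose sc (x : forall i, V i) : forall i, V i := dfwith x i0 (a *: x i0).
  exists ([seq sc x | x <- s] ++ s').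
  rewrite big_cat big_map/= scaler_sumr; congr (_ + _).
  by apply: eq_bigr => x _; rewrite /sc multilinearZ ?dfwith_id//; exact: tauT.1.
have f0 : f \o tau = (fun=> 0).
  by apply/funext => x /=; apply: fS; exists [:: x]; rewrite big_seq1.
have [|g [_ guniq]] := tauT.2 R^o (fun=> 0).
  by move=> x i a u v /=; rewrite scaler0 addr0.
have gf : g = f by apply: guniq; split=> // a x y; rewrite linearP.
have g0 : g = (fun=> 0).
  by apply: guniq; split=> // a x y /=; rewrite scaler0 addr0.
by move: ft; rewrite -gf g0 => /esym/eqP; rewrite oner_eq0.
Qed.

Lemma tensor_additive_unique (F : zmodType) (g h : T -> F) :
  {morph g : x y / x + y} -> {morph h : x y / x + y} ->
  g \o tau = h \o tau -> g = h.
Proof.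
move=> gA hA gh; apply/funext => t; have [k [x ->]] := tensor_span t.
have sumE (f : T -> F) : {morph f : x y / x + y} ->
    f (\sum_(l < k) tau (x l)) = \sum_(l < k) f (tau (x l)).
  move=> fA; apply: (big_morph f fA).
  by apply: (addrI (f 0)); rewrite -fA !addr0.
rewrite !sumE//; apply: eq_bigr => l _.
by have /funeqP/(_ (x l)) := gh.
Qed.

(** Letting a scalar [s] act on a slot turns [f] into the map [fhat] with values in the module of
    additive functions. It is multilinear because the slot may be chosen freely; its linear
    factorization is then evaluated at [s = 1]. *)
Lemma tensor_additive_factor (F : zmodType) (f : (forall i, V i) -> F) :
  multiadditive f ->
  (forall (x : forall i, V i) i j a, f (dfwith x i (a *: x i)) = f (dfwith x j (a *: x j))) ->
  exists2 g : T -> F, {morph g : x y / x + y} & g \o tau = f.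
Proof.
move=> fA fbal.
have fhat_subproof (x : forall i, V i) :
    (fun s : R => f (dfwith x i0 (s *: x i0))) \in @additive_pred R F.
  by apply/asboolP => s t; rewrite scalerDl fA.
pose fhat (x : forall i, V i) : additive_fun R F := AdditiveFun (fhat_subproof x).
have fhatE (x : forall i, V i) i s : fhat x s = f (dfwith x i (s *: x i)) by exact: fbal.
have [|g [[gL gE] _]] := tauT.2 _ fhat.
  move=> x i a y z; apply/val_inj/funext => s.
  rewrite -[LHS]/(fhat (dfwith x i (a *: y + z)) s).
  rewrite -[RHS]/(fhat (dfwith x i y) (s * a) + fhat (dfwith x i z) s).
  rewrite !(fhatE _ i) !dfwithin !dfwith_dfwith scalerDr scalerA.
  exact: fA.
exists (fun t => g t 1).
  by move=> x y; have := gL 1 x y; rewrite !scale1r => ->.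
apply/funext => x /=; have /funeqP/(_ x)/= -> := gE.
by rewrite /= scale1r dfwith_id.
Qed.

End tensor_product.

(** * Separation of points *)

Section dependent_cons.
Variables (n : nat) (K : 'I_n.+1 -> Type).

(** The induction on the number of factors splits families at [ord0]; the casts follow the equations
    given by [unliftP]. *)
Definition dcons (x0 : K ord0) (x : forall j : 'I_n, K (lift ord0 j)) i : K i :=
  match unliftP ord0 i with
  | UnliftSome j e => ecast i (K i) (esym e) (x j)
  | UnliftNone e => ecast i (K i) (esym e) x0
  end.

Lemma dcons0 x0 x : dcons x0 x ord0 = x0.
Proof.
rewrite /dcons; case: unliftP => [j e|e].
  by exfalso; have := neq_lift ord0 j; rewrite -e eqxx.
by rewrite (eq_irrelevance e erefl).
Qed.

Lemma dconsS x0 x j : dcons x0 x (lift ord0 j) = x j.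
Proof.
rewrite /dcons; case: unliftP => [k e|e]; last first.
  by exfalso; have := neq_lift ord0 j; rewrite e eqxx.
have kj := lift_inj e; subst k.
by rewrite (eq_irrelevance e erefl).
Qed.

Lemma ordS_forall (P : forall i, K i -> Prop) (x : forall i, K i) :
  P ord0 (x ord0) -> (forall j : 'I_n, P (lift ord0 j) (x (lift ord0 j))) ->
  forall i, P i (x i).
Proof. by move=> P0 PS i; case: (unliftP ord0 i) => [j|] ->. Qed.

Lemma dcons_eq (x : forall i, K i) x0 x' : x ord0 = x0 ->
  (forall j, x (lift ord0 j) = x' j) -> x = dcons x0 x'.
Proof.
move=> h0 hS; apply/functional_extensionality_dep => i.
by case: (unliftP ord0 i) => [j|] ->; rewrite ?dcons0 ?dconsS.
Qed.

Lemma dfwith_dcons0 x0 x y : dfwith (dcons x0 x) ord0 y = dcons y x.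
Proof.
apply: dcons_eq => [|j]; first by rewrite dfwithin.
by rewrite dfwithout ?neq_lift// dconsS.
Qed.

Lemma dfwith_dconsS x0 x j y :
  dfwith (dcons x0 x) (lift ord0 j) y = dcons x0 (dfwith x j y).
Proof.
apply: dcons_eq => [|k]; first by rewrite dfwithout 1?eq_sym ?neq_lift// dcons0.
have [<-|jk] := eqVneq j k; first by rewrite !dfwithin.
by rewrite dfwithout ?(inj_eq lift_inj)// dfwithout// dconsS.
Qed.

Lemma dcons_eta (x : forall i, K i) : x = dcons (x ord0) (fun j => x (lift ord0 j)).
Proof. exact: dcons_eq. Qed.

End dependent_cons.

Section multilinear_cons.
Variables (R : pzRingType) (n : nat) (V : 'I_n.+1 -> lmodType R).
Local Notation V' := (fun j : 'I_n => V (lift ord0 j)).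

Lemma multilinear_dcons (W : lmodType R) (f : (forall i, V i) -> W) (x0 : V ord0) :
  multilinear f -> multilinear (V := V') (fun x => f (dcons (K := V) x0 x)).
Proof.
move=> fL x j a y z; have := fL (dcons (K := V) x0 x) (lift ord0 j) a y z.
by rewrite /= !dfwith_dconsS.
Qed.

(** This is the source of linear maps on the full tensor product: contractions of the first factor
    or of the remaining ones. *)
Lemma multilinear_pairing (T' W : lmodType R) (tau' : (forall j, V' j) -> T')
    (b : V ord0 -> T' -> W) :
  multilinear tau' -> (forall z, linear (b^~ z)) -> (forall x, linear (b x)) ->
  multilinear (fun x : forall i, V i => b (x ord0) (tau' (fun j => x (lift ord0 j)))).
Proof.
move=> tauL bl br x i a.
case: (unliftP ord0 i) => [j|] -> y z /=.
  have E0 w : dfwith x (lift ord0 j) w ord0 = x ord0.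
    by rewrite dfwithout// eq_sym neq_lift.
  have E1 w : (fun k => dfwith x (lift ord0 j) w (lift ord0 k)) =
      dfwith (T := V') (fun k => x (lift ord0 k)) j w.
    apply/functional_extensionality_dep => k.
    have [<-|jk] := eqVneq j k; first by rewrite !dfwithin.
    by rewrite !dfwithout// (inj_eq lift_inj).
  by rewrite !E0 !E1 tauL br.
have E1 w : (fun k => dfwith x ord0 w (lift ord0 k)) = (fun k => x (lift ord0 k)).
  by apply/functional_extensionality_dep => k; rewrite dfwithout// neq_lift.
by rewrite !dfwithin !E1 bl.
Qed.

End multilinear_cons.

Lemma tensor_separation (R : realType) (n : nat)
    (E : 'I_n.+1 -> topologicalLmodType R) (T : lmodType R)
    (tau : (forall i, E i) -> T) (t : T) :
  is_tensor_product tau -> (forall i, hausdorff_space (E i)) -> t <> 0 ->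
  exists2 U : nat -> forall j, set (E j),
    forall k j, nbhs (0 : E j) (U k j) /\ balanced (U k j) &
    forall k (x : 'I_k -> forall j, E j), (forall (l : 'I_k) j, U l j (x l j)) ->
      t <> \sum_(l < k) tau (x l).
Proof.
elim: n => [|n IHn] in E T tau t * => tauT hE t0.
  (* With a single factor, [tau] is inverse to this projection, and separation takes place in
     [E ord0]. *)
  have [|p [[pL pE] _]] := tauT.2 (E ord0) (fun x => x ord0).
    by move=> x i; rewrite (ord1 i) => a u v /=; rewrite !dfwithin.
  have {pL}[q pq] := linear_fun pL; subst p.
  have qtau x : q (tau x) = x ord0 by have /funeqP/(_ x) := pE.
  have [k0 [x0 tE]] := tensor_span ord0 tauT t.
  have qt : q t <> 0.
    have tauA := multilinear_additive tauT.1.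
    pose z : forall i, E i := fun=> 0.
    have xE l : x0 l = dfwith z ord0 (x0 l ord0).
      apply/functional_extensionality_dep => i.
      by rewrite (ord1 i) dfwithin.
    move=> qt0; apply: t0; rewrite tE.
    under eq_bigr do rewrite xE.
    rewrite -multiadditive_sum// (multiadditive0 tauA (i := ord0))// dfwithin.
    transitivity (q t) => //.
    by rewrite tE linear_sum; apply: eq_bigr => l _; rewrite qtau.
  have [U U0 Ut] := hausdorff_nbhs0 (hE ord0) qt.
  have [V V0 VU] := balanced_nbhs_sum U0.
  exists (fun k => dcons (K := fun i => set (E i)) (V k) (fun=> setT)) => [k|].
    apply: (ordS_forall (P := fun i U => nbhs (0 : E i) U /\ balanced U)).
      by rewrite dcons0.
    by case.
  move=> k x Vx tkE; apply: Ut; rewrite tkE linear_sum.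
  under eq_bigr do rewrite qtau.
  by apply: VU => l; have := Vx l ord0; rewrite dcons0.
pose E' j := E (lift ord0 j).
have [T' [tau' tauT']] := tensor_product_exists E'.
pose y0 (x : forall i, E i) : forall j, E' j := fun j => x (lift ord0 j).
have [m [e tE]] := tensor_span ord0 tauT t.
(* Regrouping over the independent vectors [e (h q) ord0] writes [t] as the sum of their tensors
   with [F q]. *)
have [r [h [d [hfree eE]]]] := lin_indep_extraction (fun i : 'I_m => e i ord0).
pose F q := \sum_(i < m) d i q *: tau' (y0 (e i)).
(* The maps [G x0] tensor with [x0] on the left and rebuild [t] from the [F q], so these cannot all
   vanish. *)
have [q Fq] : exists q, F q <> 0.
  apply/existsNP => F0; apply: t0; rewrite tE.
  have /choice[G GP] : forall x0, exists g : {linear T' -> T},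
      forall x, g (tau' x) = tau (dcons (K := E) x0 x).
    move=> x0.
    have [|g [[/linear_fun[g' ->] gE] _]] := tauT'.2 T (fun x => tau (dcons (K := E) x0 x)).
      exact: (multilinear_dcons (V := E)) tauT.1.
    by exists g' => x; have /funeqP/(_ x) := gE.
  transitivity (\sum_(s < r) G (e (h s) ord0) (F s)); last first.
    by rewrite big1// => s _; rewrite F0 linear0.
  under [RHS]eq_bigr do rewrite /F linear_sum.
  rewrite exchange_big/=; apply: eq_bigr => i _.
  under eq_bigr do rewrite linearZ/= GP.
  rewrite {1}(dcons_eta (e i)) eE -(dfwith_dcons0 (K := E) 0).
  rewrite multiadditive_sum; last exact: multilinear_additive tauT.1.
  apply: eq_bigr => s _; rewrite multilinearZ ?dfwith_dcons0//; exact: tauT.1.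
have [U' U'0 FU'] := IHn _ _ _ _ tauT' (fun j => hE (lift ord0 j)) Fq.
have [U0 U00 U0b] := bounded_coordinates (hE ord0) hfree.
have [V V0 VU0] := balanced_nbhs_sum U00.
exists (fun l => dcons (K := fun i => set (E i)) (V l) (U' l)) => [l|k x Ux tkE].
  apply: (ordS_forall (P := fun i U => nbhs (0 : E i) U /\ balanced U)).
    by rewrite dcons0.
  by move=> j; rewrite dconsS; exact: U'0.
have Vx (l : 'I_k) : V l (x l ord0) by have := Ux l ord0; rewrite dcons0.
have U'x (l : 'I_k) j : U' l j (y0 (x l) j).
  by have := Ux l (lift ord0 j); rewrite dconsS.
pose y (l : 'I_k) := tau' (y0 (x l)).
have [p [g [c [gfree yE c1]]]] := bounded_extraction y.
(* [phi s] reads off coordinates in the extracted subfamily of [y]; below, [psi] does so for the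
   vectors [e (h s) ord0]. *)
have /choice[phi phiE] : forall s, exists f : {scalar T'},
    forall t, f ((y \o g) t) = (t == s)%:R.
  by move=> s; exact: dual_functional.
have phiy s l : phi s (y l) = c l s.
  rewrite yE linear_sum (bigD1 s)//= linearZ/= phiE eqxx mulr1 big1 ?addr0// => s' ss'.
  by rewrite linearZ/= phiE (negbTE ss') mulr0.
have [psi psiE] : exists f : {scalar E ord0}, forall s, f (e (h s) ord0) = (s == q)%:R.
  exact: dual_functional hfree.
have contract (W : lmodType R) (b : E ord0 -> T' -> W) :
    (forall z, linear (b^~ z)) -> (forall x, linear (b x)) ->
    exists B : {linear T -> W}, forall x, B (tau x) = b (x ord0) (tau' (y0 x)).
  move=> bl br.
  have [|B [[/linear_fun[B' ->] BE] _]] := tauT.2 W (fun x => b (x ord0) (tau' (y0 x))).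
    exact: (multilinear_pairing (V := E)) tauT'.1 bl br.
  by exists B' => z; have /funeqP/(_ z) := BE.
(* [A s] contracts the remaining factors by [phi s], while [B] contracts the first factor by [psi].
   Each is evaluated on both decompositions of [t]. *)
have /choice[A AE] : forall s, exists A : {linear T -> E ord0},
    forall x, A (tau x) = phi s (tau' (y0 x)) *: x ord0.
  move=> s; apply: (contract _ (fun v z => phi s z *: v)) => [z|v] a u w.
    by rewrite scalerDr !scalerA mulrC.
  by rewrite linearP scalerDl scalerA.
have [B BE] : exists B : {linear T -> T'},
    forall x, B (tau x) = psi (x ord0) *: tau' (y0 x).
  apply: (contract _ (fun v z => psi v *: z)) => [z|v] a u w.
    by rewrite linearP scalerDl scalerA.
  by rewrite scalerDr !scalerA mulrC.
have At s : A s t = \sum_(q < r) phi s (F q) *: e (h q) ord0.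
  rewrite tE linear_sum; under eq_bigr do rewrite AE eE scaler_sumr.
  rewrite exchange_big/=; apply: eq_bigr => q' _.
  rewrite linear_sum scaler_suml; apply: eq_bigr => i _.
  by rewrite [phi s (_ *: _)]linearZ/= scalerA mulrC.
have At' s : A s t = \sum_(l < k) c l s *: x l ord0.
  by rewrite tkE linear_sum; apply: eq_bigr => l _; rewrite AE -/(y l) phiy.
(* The second decomposition puts [A s t] into [U0]; the first exhibits [phi s (F q)] as one of its
   coordinates. *)
have phiF s : `|phi s (F q)| <= 1.
  have : U0 (A s t).
    by rewrite At'; apply: VU0 => l; have [_] := V0 l; apply; [exact: c1|exact: Vx].
  by rewrite At => /(U0b (fun q => phi s (F q))).
have BtF : B t = F q.
  rewrite tE linear_sum; apply: eq_bigr => i _; rewrite BE eE; congr (_ *: _).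
  rewrite linear_sum (bigD1 q)//= linearZ/= psiE eqxx mulr1 big1 ?addr0// => s ss.
  by rewrite linearZ/= psiE (negbTE ss) mulr0.
have psiA s : psi (A s t) = phi s (F q).
  rewrite At linear_sum (bigD1 q)//= linearZ/= psiE eqxx mulr1 big1 ?addr0// => s' ss.
  by rewrite linearZ/= psiE (negbTE ss) mulr0.
have FE : F q = \sum_(s < p) phi s (F q) *: y (g s).
  rewrite -[LHS]BtF tkE linear_sum.
  under eq_bigr do rewrite BE -/(y _) yE scaler_sumr.
  rewrite exchange_big/=; apply: eq_bigr => s _.
  rewrite -psiA At' linear_sum scaler_suml; apply: eq_bigr => l _.
  by rewrite [psi (_ *: _)]linearZ/= scalerA mulrC.
(* [a l] is the coefficient of [y l] in [F q]. As [g] is injective, at most one term occurs, so the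
   bound 1 persists. *)
pose a l := \sum_(s < p | g s == l) phi s (F q).
have a1 l : `|a l| <= 1.
  rewrite /a; have [[s gs]|/forallNP gs] := pselect (exists s, g s == l).
    rewrite (big_pred1 s) // => s'.
    by rewrite -(eqP gs) (inj_eq (lin_indep_inj gfree)).
  by rewrite big_pred0 ?normr0// => s; apply/negP/gs.
(* The coefficient enters one remaining slot, where the balanced set [U' l ord0] absorbs it; this
   contradicts the choice of [U']. *)
pose z l : forall j, E' j := dfwith (y0 (x l)) ord0 (a l *: y0 (x l) ord0).
apply: (FU' k z) => [l j|].
  rewrite /z; have [<-|j0] := eqVneq ord0 j; last by rewrite dfwithout.
  by rewrite dfwithin; have [_] := U'0 l ord0; apply.
rewrite FE (partition_big g predT)//=; apply: eq_bigr => l _.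
rewrite /z multilinearZ; last exact: tauT'.1.
rewrite dfwith_id scaler_suml; apply: eq_bigr => s /eqP ->.
by [].
Qed.

(** * Continuous multiadditive maps *)

(** With [d] the denominator, both sides are the same integer multiple of [b] at [d^-1 *: u] and
    [d^-1 *: v], as integers pass out of either argument. *)
Lemma rational_homogeneity (R : realType) (U V : lmodType R) (F : zmodType)
    (b : U -> V -> F) (q : rat) u v :
  (forall v, {morph b^~ v : x y / x + y}) -> (forall u, {morph b u : x y / x + y}) ->
  b (ratr q *: u) v = b u (ratr q *: v).
Proof.
move=> bl br.
have intE (W : zmodType) (h : W -> F) : {morph h : x y / x + y} ->
    forall x m, h (x *~ m) = h x *~ m.
  move=> hA; have h0 : h 0 = 0 by apply: (addrI (h 0)); rewrite -hA !addr0.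
  have hN x : h (- x) = - h x by apply/eqP; rewrite -addr_eq0 -hA addNr h0.
  have hn x k : h (x *+ k) = h x *+ k.
    by elim: k => [|k IHk]; rewrite ?mulr0n// !mulrS hA IHk.
  by move=> x [k|k]; rewrite ?NegzE ?mulrNz -?pmulrn ?hN hn.
pose d : R := (denq q)%:~R.
have d0 : d != 0 by rewrite intr_eq0 denq_neq0.
have uE : u = (d^-1 *: u) *~ denq q by rewrite -scaler_int scalerA mulfV// scale1r.
have vE : v = (d^-1 *: v) *~ denq q by rewrite -scaler_int scalerA mulfV// scale1r.
have -> : ratr q *: u = (d^-1 *: u) *~ numq q by rewrite -scaler_int scalerA.
have -> : ratr q *: v = (d^-1 *: v) *~ numq q by rewrite -scaler_int scalerA.
rewrite [in LHS]vE [in RHS]uE.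
rewrite (intE _ _ (bl _)) (intE _ _ (br _)) (intE _ _ (bl _)) (intE _ _ (br _)).
by rewrite -!mulrzA mulrC.
Qed.

Lemma continuous_multiadditive_balanced (R : realType) (n : nat)
    (E : 'I_n -> topologicalLmodType R) (F : topologicalZmodType)
    (f : prod_topology E -> F) : hausdorff_space F ->
  multiadditive f -> continuous f ->
  forall (x : forall i, E i) i j (a : R),
    f (dfwith x i (a *: x i)) = f (dfwith x j (a *: x j)).
Proof.
move=> hF fA fC x i j a.
have [->//|ij] := eqVneq i j.
pose h (a : R^o) : F := f (dfwith x i (a *: x i)) - f (dfwith x j (a *: x j)).
have partC k : continuous (fun a : R^o => f (dfwith x k (a *: x k))).
  move=> c; apply: (@continuous_comp R^o (E k) F (fun a : R^o => (a : R) *: x k)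
    (fun y => f (dfwith x k y))); first exact: (@lmod_scalel_continuous R (E k) (x k) c).
  apply: (@continuous_comp _ (prod_topology E) _ (fun y => dfwith x k y) f).
    exact: (@dfwith_continuous _ (fun i => E i) x k).
  exact: fC.
have hC : continuous h.
  move=> c; apply: (@continuous_comp _ _ _
    (fun a : R^o => (f (dfwith x i (a *: x i)), f (dfwith x j (a *: x j))))
    (fun z : F * F => z.1 - z.2)); last exact: sub_continuous.
  exact: cvg_pair (partC i c) (partC j c).
have hq q : h (ratr q) = 0.
  (* Freezing all slots except [i] and [j] leaves a biadditive map. *)
  pose b (u : E i) (v : E j) := f (dfwith (dfwith x i u) j v).
  have bi u : b u (x j) = f (dfwith x i u).
    by rewrite /b dfwithC// dfwith_id.
  have bj v : b (x i) v = f (dfwith x j v) by rewrite /b dfwith_id.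
  rewrite /h -bi -bj (@rational_homogeneity _ _ _ _ b) ?subrr//.
    by move=> v u u'; rewrite /b !(dfwithC _ _ _ ij) fA.
  by move=> u v v'; rewrite /b fA.
(* If nonempty, this open set would contain a rational, where [h] vanishes. *)
have oN : open (h @^-1` (~` [set 0])).
  apply: open_comp; first by move=> c _; exact: hC.
  exact/closed_openC/accessible_closed_set1/hausdorff_accessible.
apply/eqP; rewrite -subr_eq0; apply/negPn/negP => /eqP ha.
have [|c [/= hc [q _ qc]]] := @dense_rat R _ _ oN; first by exists a.
by apply: hc; rewrite -qc; exact: hq.
Qed.

(** * The topology of the tensor product *)

Section tensor_basis.
Variables (R : realType) (n : nat) (E : 'I_n -> topologicalLmodType R) (i0 : 'I_n).
Variables (T : lmodType R) (tau : (forall i, E i) -> T).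
Hypothesis tauT : is_tensor_product tau.

Let zero : forall j, E j := fun=> 0.

Let tauA : multiadditive tau.
Proof. by apply: multilinear_additive; exact: tauT.1. Qed.

Let tau0 : tau zero = 0.
Proof. exact: (multiadditive0 tauA (i := i0)). Qed.

(** A form of the basic sets with finite families, in which the empty sum is allowed; for admissible
    [U] it describes the same set. *)
Definition sumset (U : nat -> forall j, set (E j)) : set T :=
  [set w | exists k (x : 'I_k -> forall j, E j),
    (forall (l : 'I_k) j, U l j (x l j)) /\ w = \sum_(l < k) tau (x l)].

Definition admissible (U : nat -> forall j, set (E j)) : Prop :=
  forall k j, nbhs (0 : E j) (U k j) /\ balanced (U k j).

(** Padding by the zero family, which lies in every box and has tensor 0, gives representations of
    any larger length. *)
Lemma sumset_nat U w : admissible U -> sumset U w ->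
  exists k (x : nat -> forall j, E j), forall K, (k <= K)%N ->
    (forall l j, U l j (x l j)) /\ w = \sum_(l < K) tau (x l).
Proof.
move=> Uadm [k [x [Ux ->]]].
pose x' l := if insub l is Some i then x i else zero.
exists k, x' => K kK; split=> [l j|].
  rewrite /x'; case: insubP => [i _ <-|_]; first exact: Ux.
  by have [/nbhs_singleton] := Uadm l j.
rewrite -(big_mkord xpredT (fun l => tau (x' l))) (big_cat_nat _ kK)//=.
rewrite big_mkord [X in _ + X]big1_seq ?addr0 => [|l].
  by apply: eq_bigr => l _; rewrite /x' valK.
rewrite mem_index_iota => /and3P[_ kl _].
by rewrite /x' insubF ?tau0// ltnNge kl.
Qed.

Lemma tensor_nbhs_basisE : tensor_nbhs_basis tau =
  [set W | exists2 U, admissible U & W = sumset U].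
Proof.
suff UE U : admissible U -> \bigcup_k minkowski_sum k.+1
    (fun l => tau @` [set x : forall j, E j | forall j, U l j (x j)]) = sumset U.
  apply/seteqP; split=> W.
    by move=> [U [Uadm ->]]; exists U => //; exact: UE.
  by move=> [U Uadm ->]; exists U; split=> //; rewrite UE.
move=> Uadm; apply/seteqP; split=> w.
  move=> [k _ [y yU <-]].
  have /choice[x xP] : forall l : 'I_k.+1, exists x : forall j, E j,
      (forall j, U l j (x j)) /\ tau x = y l.
    by move=> l; have [x Ux xy] := yU l (ltn_ord l); exists x.
  exists k.+1, x; split=> [l|]; first exact: (xP l).1.
  by apply: eq_bigr => l _; rewrite (xP l).2.
(* One extra term is added because the union starts with sums of length 1. *)
move=> /(sumset_nat Uadm)[k [x /(_ _ (leqnSn k))[Ux ->]]].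
exists k => //; exists (fun l => tau (x l)) => // l _.
by exists (x l).
Qed.

Lemma sumsetS U V : (forall l j, U l j `<=` V l j) -> sumset U `<=` sumset V.
Proof.
by move=> UV w [k [x [Ux ->]]]; exists k, x; split=> // l j; exact: UV.
Qed.

(** Two sums are interleaved, the first at even and the second at odd positions; hence [V l] lies in
    both [U l.*2] and [U l.*2.+1]. *)
Lemma sumset_half U : admissible U -> exists2 V, admissible V &
  forall w w', sumset V w -> sumset V w' -> sumset U (w + w').
Proof.
move=> Uadm.
pose V l j := U l.*2 j `&` U l.*2.+1 j.
have Vadm : admissible V.
  move=> l j; have [? b1] := Uadm l.*2 j; have [? b2] := Uadm l.*2.+1 j.
  by split; [exact: filterI|move=> a v a1 [? ?]; split; [exact: b1|exact: b2]].
exists V => // w w' /(sumset_nat Vadm)[k [x xP]] /(sumset_nat Vadm)[k' [x' xP']].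
have [Vx ->] := xP (maxn k k') (leq_maxl _ _).
have [Vx' ->] := xP' (maxn k k') (leq_maxr _ _).
move: (maxn k k') => K.
pose z l := if odd l then x' l./2 else x l./2.
exists K.*2, (fun l => z l); split=> [l j|].
  rewrite /z; move: (nat_of_ord l) => {}l.
  rewrite -[in U l j](odd_double_half l).
  by case: (odd l); rewrite ?add0n ?add1n; [have [] := Vx' l./2 j|have [] := Vx l./2 j].
elim: K => [|K IHK]; first by rewrite !big_ord0 addr0.
rewrite doubleS !big_ord_recr/= addrACA IHK -addrA; congr (_ + (_ + _)).
  by rewrite /z odd_double doubleK.
by rewrite /z /= odd_double uphalf_double.
Qed.

Lemma sumset_balanced U : admissible U -> balanced (sumset U).
Proof.
move=> Uadm a w a1 [k [x [Ux ->]]].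
exists k, (fun l => dfwith (x l) i0 (a *: x l i0)); split=> [l j|].
  have [<-|ij] := eqVneq i0 j; last by rewrite dfwithout.
  by rewrite dfwithin; have [_] := Uadm l i0; apply.
rewrite scaler_sumr; apply: eq_bigr => l _.
by rewrite multilinearZ ?dfwith_id//; exact: tauT.1.
Qed.

Lemma sumset_absorbing U t : admissible U -> exists2 e : R, 0 < e & sumset U (e *: t).
Proof.
move=> Uadm; have [k [x ->]] := tensor_span i0 tauT t.
have : \forall e \near (0 : R^o), forall (l : 'I_k) j, U l j (e *: x l j).
  apply: (@filter_forall R^o _ (fun l e => forall j, U (l : 'I_k) j ((e : R) *: x l j))
    _ (nbhs_filter (0 : R^o))) => l.
  apply: (@filter_forall R^o _ (fun j e => U l j ((e : R) *: x l j))
    _ (nbhs_filter (0 : R^o))) => j.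
  by apply: nbhs_absorbing; have [] := Uadm l j.
move=> /nbhs_ballP[d /= d0 dU].
have e0 : 0 < d / 2 by rewrite divr_gt0.
(* Each of the [n] slots is scaled by [d / 2]. *)
exists ((d / 2) ^+ n); first exact: exprn_gt0.
exists k, (fun l j => (d / 2) *: x l j); split=> [l j|].
  apply: dU; rewrite /ball/= sub0r normrN gtr0_norm// ltr_pdivrMr// ltr_pMr//.
  by rewrite ltr1n.
rewrite scaler_sumr; apply: eq_bigr => l _.
by rewrite (multilinear_scale (fun=> d / 2)) ?prodr_const ?card_ord//; exact: tauT.1.
Qed.

End tensor_basis.

Section tensor_topology.
Variables (R : realType) (n : nat) (E : 'I_n -> topologicalLmodType R) (i0 : 'I_n).
Variables (T : lmodType R) (tau : (forall i, E i) -> T).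
Hypothesis tauT : is_tensor_product tau.

Let B : set_system T := [set W | exists2 U, admissible U & W = sumset (E := E) tau U].

Let BI U V : B U -> B V -> exists2 W, B W & W `<=` U `&` V.
Proof.
move=> [A Aadm ->] [A' A'adm ->].
exists (sumset (E := E) tau (fun l j => A l j `&` A' l j)).
  exists (fun l j => A l j `&` A' l j) => // l j.
  have [? b1] := Aadm l j; have [? b2] := A'adm l j.
  by split; [exact: filterI|move=> a v a1 [? ?]; split; [exact: b1|exact: b2]].
by move=> w Aw; split; apply: sumsetS Aw => l j v [].
Qed.

Let BD U : B U -> exists2 V, B V & forall x y, V x -> V y -> U (x + y).
Proof.
move=> [A Aadm ->]; have [A' A'adm AA'] := sumset_half i0 tauT Aadm.
by exists (sumset (E := E) tau A') => //; exists A'.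
Qed.

Let Bbal U : B U -> balanced U.
Proof. by move=> [A Aadm ->]; exact: (sumset_balanced i0 tauT Aadm). Qed.

Let Babs U x : B U -> exists2 e : R, 0 < e & U (e *: x).
Proof. by move=> [A Aadm ->]; exact: (sumset_absorbing i0 tauT x Aadm). Qed.

Let B0 : B !=set0.
Proof.
exists (sumset (E := E) tau (fun _ _ => setT)); exists (fun _ _ => setT) => // k j.
by split=> //; exact: filterT.
Qed.

Definition tensor_topology : topology T := basis_topology BI B0.

Lemma tensor_topology_vector : is_vector_topology tensor_topology.
Proof. exact: basis_topology_vector. Qed.

Local Notation TO := (topologized tensor_topology).

Lemma nbhs_tensor_topology (x : TO) (A : set T) :
  nbhs x A <-> exists2 U, admissible U & forall u, sumset (E := E) tau U u -> A (x + u).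
Proof.
rewrite nbhs_basis_topology//.
split=> [[_ [U Uadm ->] UA]|[U Uadm UA]]; first by exists U.
by exists (sumset (E := E) tau U) => //; exists U.
Qed.

Lemma nbhs0_tensor_topology :
  nbhs (0 : TO) = filter_from (tensor_nbhs_basis tau) id.
Proof.
rewrite (tensor_nbhs_basisE i0 tauT); apply/seteqP; split=> A.
  move=> /nbhs_tensor_topology[U Uadm UA]; exists (sumset (E := E) tau U).
    by exists U.
  by move=> u /UA; rewrite add0r.
move=> [_ [U Uadm ->] UA]; apply/nbhs_tensor_topology; exists U => // u Uu.
by rewrite add0r; exact: UA.
Qed.

(** The difference [tau z - tau x] telescopes into [n] pure tensors, the [i]-th with [z i - x i] in
    slot [i]. Scaling the other slots by a small [e] and slot [i] by the inverse of [e ^+ n.-1]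
    preserves each tensor and moves its entries into the box [U i]. *)
Lemma tensor_map_continuous : continuous (tau : prod_topology E -> TO).
Proof.
move=> x A /nbhs_tensor_topology[U Uadm UA].
have tauL := tauT.1.
have tauA := multilinear_additive tauL.
(* Asking [U i j] to be a neighbourhood of [e *: x j] makes it contain [e *: z j] as well for [z]
   near [x]. *)
have : \forall e \near (0 : R^o), forall i j : 'I_n,
    nbhs (e *: (x : forall i, E i) j) (U i j).
  apply: (@filter_forall R^o _
    (fun i e => forall j, nbhs ((e : R) *: (x : forall i, E i) j) (U (i : 'I_n) j))
    _ (nbhs_filter (0 : R^o))) => i.
  apply: (@filter_forall R^o _
    (fun j e => nbhs ((e : R) *: (x : forall i, E i) j) (U i j))
    _ (nbhs_filter (0 : R^o))) => j.
  apply: (@nbhs_absorbing R (E j) (x j) (fun v => nbhs v (U i j))).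
  by apply: nbhs_interior; have [] := Uadm i j.
move=> /nbhs_ballP[d /= d0 dU].
pose e := d / 2.
have e0 : 0 < e by rewrite divr_gt0.
have {dU}eU (i j : 'I_n) : nbhs (e *: (x : forall i, E i) j) (U i j).
  apply: dU; rewrite /ball/= sub0r normrN gtr0_norm// ltr_pdivrMr// ltr_pMr//.
  by rewrite ltr1n.
pose c := e ^+ n.-1.
pose Q (j : 'I_n) (v : E j) := (forall i : 'I_n, U i j (e *: v)) /\
  U j j (c^-1 *: (v - (x : forall i, E i) j)).
have : \forall z \near (x : prod_topology E), forall j, Q j (z j).
  apply: (@nbhs_box _ (fun i => E i) x Q) => j; apply: filterI.
    apply: (@filter_forall _ _ (fun (i : 'I_n) v => U i j (e *: v)) _ (nbhs_filter _)) => i.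
    exact: lmod_scaler_continuous (eU i j).
  apply: (@nbhs_translate (E j) (x j) (fun v => U j j (c^-1 *: v))).
  apply: lmod_scaler_continuous; rewrite scaler0.
  by have [] := Uadm j j.
apply: (@filterS _ _ (nbhs_filter (x : prod_topology E))) => z Qz /=.
rewrite -(subrK (tau x) (tau z)) addrC; apply: UA.
(* The path from [x] to [z] replaces the first [i] entries. *)
pose p (i : nat) : forall j, E j := fun j => if (j < i)%N then z j else x j.
have p0 : p 0%N = x by [].
have pn : p n = z.
  by apply/functional_extensionality_dep => j; rewrite /p ltn_ord.
have step (i : 'I_n) : tau (p i.+1) - tau (p i) = tau (dfwith (p i) i (z i - x i)).
  rewrite multiadditiveB//; congr (tau _ - tau _).
    apply/functional_extensionality_dep => j; rewrite /p.
    have [<-|ij] := eqVneq i j; first by rewrite dfwithin ltnSn.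
    by rewrite dfwithout// ltnS leq_eqVlt val_eqE eq_sym (negbTE ij).
  have -> : x i = p i i by rewrite /p ltnn.
  by rewrite dfwith_id.
pose a (i j : 'I_n) : R := if j == i then c^-1 else e.
have a1 (i : 'I_n) : \prod_j a i j = 1.
  rewrite (bigD1 i)//= /a eqxx (eq_bigr (fun=> e)); last by move=> j /negbTE ->.
  rewrite prodr_const -[#|_|]/(#|predC1 i|) cardC1 card_ord mulVf//.
  by rewrite gt_eqF// exprn_gt0.
exists n, (fun i j => a i j *: dfwith (p i) i (z i - x i) j); split=> [i j|].
  rewrite /a; have [->|ji] := eqVneq j i; first by rewrite dfwithin; exact: (Qz i).2.
  rewrite dfwithout 1?eq_sym// /p; case: ifP => _; first exact: (Qz j).1.
  exact: nbhs_singleton (eU i j).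
rewrite -p0 -[in LHS]pn -(telescope_sumr (fun i => tau (p i)))// big_mkord.
by apply: eq_bigr => i _; rewrite step multilinear_scale// a1 scale1r.
Qed.

(** By additivity, continuity at zero suffices. Continuity of [g \o tau] at the zero family gives
    boxes sent into [V k], and sums from the [V k] stay in the prescribed neighbourhood. *)
Lemma tensor_factor_continuous (F : topologicalZmodType) (g : T -> F) :
  {morph g : x y / x + y} -> continuous (g \o tau : prod_topology E -> F) ->
  continuous (g : TO -> F).
Proof.
move=> gA fC x A /nbhs_translate0 /nbhs_sum[V V0 VA].
have g0 : g 0 = 0 by apply: (addrI (g 0)); rewrite -gA !addr0.
pose zero : forall j, E j := fun=> 0.
have gtau0 : g (tau zero) = 0.
  by rewrite (multiadditive0 (multilinear_additive tauT.1) (i := i0)).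
have /choice[U UP] : forall k, exists U : forall j, set (E j),
    (forall j, nbhs (0 : E j) (U j) /\ balanced (U j)) /\
    forall y, (forall j, U j (y j)) -> V k (g (tau y)).
  move=> k.
  have : nbhs ((g \o tau) (zero : prod_topology E)) (V k) by rewrite /= gtau0.
  move=> /fC /(@box_nbhs _ (fun i => E i))[W W0 WV].
  have H j : {U : set (E j) | [/\ nbhs (0 : E j) U, balanced U & U `<=` W j]}.
    by apply/cid; have [U U0 [Ub UW]] := balanced_nbhs (W0 j); exists U.
  exists (fun j => sval (H j)); split=> [j|y Uy]; first by case: (svalP (H j)).
  by apply: WV => j; case: (svalP (H j)) => _ _; apply.
apply/nbhs_tensor_topology; exists U => [k j|_ [k [y [Uy ->]]] /=]; first exact: (UP k).1.
rewrite gA (big_morph g gA g0); apply: VA => l.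
exact: (UP l).2.
Qed.

End tensor_topology.

Theorem proposition1 (R : realType) (n : nat) (hn : (2 <= n)%N)
    (E : 'I_n -> topologicalLmodType R)
    (T : lmodType R) (tau : (forall i, E i) -> T)
    (tauT : is_tensor_product tau) :
  exists (O : topology T) (OV : is_vector_topology O),
    [/\ (* (a) *)
        nbhs (0 : tvs_of OV) = filter_from (tensor_nbhs_basis tau) id,
        (* (b) *)
        continuous (tau : prod_topology E -> tvs_of OV),
        (* (c) *)
        is_tvs_tensor_product (fun _ => True)
          (tau : prod_topology E -> tvs_of OV),
        (* (d) *)
        (forall i, hausdorff_space (E i)) ->
          hausdorff_space (tvs_of OV) /\
          is_tvs_tensor_product (fun F => hausdorff_space F)
            (tau : prod_topology E -> tvs_of OV) &
        (* (e) *)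
        (forall i, hausdorff_space (E i)) ->
          is_group_tensor_product (fun F => hausdorff_space F)
            (E := fun i => E i : topologicalZmodType)
            (T := tvs_of OV : topologicalZmodType)
            (tau : prod_topology E -> tvs_of OV)].
Proof.
case: n hn E tau tauT => [//|n] hn E tau tauT.
have tauL := tauT.1.
have tauA := multilinear_additive tauL.
pose O := tensor_topology tau.
have OV : is_vector_topology O := tensor_topology_vector ord0 tauT.
exists O, OV.
have tauC : continuous (tau : prod_topology E -> tvs_of OV).
  exact: (tensor_map_continuous ord0 tauT).
(* Being stated for additive maps into groups, this serves both the linear and the group universal
   property. *)
have factorC (F : topologicalZmodType) (g : T -> F) :
    {morph g : x y / x + y} -> continuous (g \o tau : prod_topology E -> F) ->
    continuous (g : tvs_of OV -> F).
  exact: (tensor_factor_continuous ord0 tauT).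
have univ (F : topologicalLmodType R) (f : prod_topology E -> F) :
    multilinear f -> continuous f ->
    exists! g : tvs_of OV -> F, [/\ linear g, continuous g & g \o tau = f].
  move=> fL fC; have [g [[gL gE] guniq]] := tauT.2 F f fL.
  exists g; split=> [|h [hL _ hE]]; last exact: guniq.
  split=> //; apply: factorC; last by rewrite gE.
  by move=> x y; have := gL 1 x y; rewrite !scale1r.
have tH : (forall i, hausdorff_space (E i)) -> hausdorff_space (tvs_of OV).
  move=> hE; apply: (@hausdorff_separate0 (tvs_of OV)) => t t0.
  have [U Uadm Ut] := tensor_separation tauT hE t0.
  exists (sumset (E := E) tau U).
    apply/(nbhs_tensor_topology ord0 tauT); exists U => // u Uu.
    by rewrite add0r.
  by move=> [k [x [Ux tE]]]; exact: Ut Ux tE.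
split=> //.
- exact: (nbhs0_tensor_topology ord0 tauT).
- by split=> // F f _; exact: univ.
- move=> hE; split; first exact: tH.
  by split=> //; [exact: tH|move=> F f _; exact: univ].
- move=> hE; split=> //; first exact: tH.
  move=> F f hF fA fC.
  have [g gA gE] := tensor_additive_factor ord0 tauT fA
    (continuous_multiadditive_balanced hF fA fC).
  exists g; split=> [|h [hA _ hE']].
    by split=> //; apply: factorC => //; rewrite gE.
  by apply: (tensor_additive_unique ord0 tauT) => //; rewrite gE.
Qed.
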